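(* Let $a$, $d$ and $k$ be positive integers with $\gcd(a,d)=1$ and $2\le k\le a$, and let $\mu\ge 0$ be an integer. Then $$ \begin{aligned} &s_\mu(a,a+d,\dots,a+(k-1)d)\\ &=\frac{1}{\mu+1}\sum_{\kappa=0}^{\mu}\sum_{l=0}^{\mu+1-\kappa}\sum_{j=0}^l\binom{\mu+1}{\kappa}\binom{\mu+1-\kappa}{l}\binom{l+1}{j}\frac{B_{\kappa}B_j a^{\mu-l}d^l}{l+1}\\ &\qquad\times\biggl(\left(\left\lfloor\frac{a-1}{k-1}\right\rfloor+1\right)^{\mu+1-\kappa-l}a^{l+1-j}-1\\ &\qquad\qquad-\sum_{i=1}^{\lfloor (a-1)/(k-1)\rfloor}\bigl((i+1)^{\mu+1-\kappa-l}-i^{\mu+1-\kappa-l}\bigr)\bigl(i(k-1)+1\bigr)^{l+1-j}\biggr)\\ &\quad+\frac{B_{\mu+1}}{\mu+1}\bigl(a^{\mu+1}-1\bigr). \end{aligned} $$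
   Context: For positive integers $a_1,\dots,a_k$ with $\gcd(a_1,\dots,a_k)=1$, $\mathrm{NR}(a_1,\dots,a_k)$ denotes the (finite) set of positive integers that cannot be written as a nonnegative integer combination of $a_1,\dots,a_k$, and $s_\mu(a_1,\dots,a_k):=\sum_{n\in \mathrm{NR}(a_1,\dots,a_k)}n^\mu$. The sequence $a,a+d,\dots,a+(k-1)d$ is the $k$-term arithmetic progression with first term $a$ and difference $d$. The Bernoulli numbers $B_n$ are defined by $\frac{x}{e^x-1}=\sum_{n=0}^\infty B_n\frac{x^n}{n!}$ (so $B_1=-\frac12$). *)

(* Defs.v *)
From HB Require Import structures.
From mathcomp Require Import all_boot all_order all_algebra.
From mathcomp Require Import boolp classical_sets functions cardinality fsbigop.

Set Implicit Arguments.
Unset Strict Implicit.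
Unset Printing Implicit Defensive.
Import Order.TTheory GRing.Theory Num.Theory.
Local Open Scope ring_scope.
Local Open Scope classical_set_scope.

(* A formal power series over rat is given by its sequence of coefficients. *)
Definition fps := nat -> rat.

Definition fps_mul (f g : fps) : fps :=
  fun n => \sum_(i < n.+1) f i * g (n - i)%N.

Definition fps_sub (f g : fps) : fps := fun n => f n - g n.

Definition fps_one : fps := fun n => (n == 0)%N%:R.

Definition fps_X : fps := fun n => (n == 1)%N%:R.

Definition egf (u : nat -> rat) : fps := fun n => u n / n`!%:R.

Definition fps_exp : fps := egf (fun=> 1).

(* x / (e^x - 1) = \sum_n B_n x^n / n! as formal power series, with the
   denominator cleared (e^x - 1 is a non-zero element of the domain Q[[x]],
   so this determines B); in particular B_1 = - 1/2. *)
Definition bernoulli_numbers (B : nat -> rat) : Prop :=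
  fps_mul (egf B) (fps_sub fps_exp fps_one) =1 fps_X.

Definition representable (s : seq nat) (n : nat) : Prop :=
  exists c : 'I_(size s) -> nat, n = (\sum_(i < size s) c i * nth 0 s i)%N.

Definition NR (s : seq nat) : set nat :=
  [set n | (0 < n)%N /\ ~ representable s n].

(* The finitely supported sum is the intended one because NR s is finite when
   the gcd of s is 1; it would be 0 by convention if NR s were infinite. *)
Definition sylvester_sum (mu : nat) (s : seq nat) : rat :=
  \sum_(n \in NR s) (n%:R ^+ mu : rat).

Definition arith_prog (a d k : nat) : seq nat :=
  mkseq (fun i => a + i * d)%N k.

Fixpoint egf_bernoulli_seq (n : nat) : seq rat :=
  if n is m.+1 then
    let s := egf_bernoulli_seq m in
    rcons s ((m == 0)%N%:R - \sum_(i < m) s`_i / (m.+1 - i)`!%:R)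
  else [::].

Lemma bernoulli_numbers_exist : exists B, bernoulli_numbers B.
Proof.
pose c n : rat := (egf_bernoulli_seq n.+1)`_n.
have sz n : size (egf_bernoulli_seq n) = n.
  by elim: n => //= n IHn; rewrite size_rcons IHn.
have cE n i : (i < n)%N -> (egf_bernoulli_seq n)`_i = c i.
  elim: n => // n IHn; rewrite ltnS leq_eqVlt => /predU1P[-> //|lt_in].
  by rewrite /= nth_rcons sz lt_in IHn.
have f0 n : n`!%:R != 0 :> rat by rewrite pnatr_eq0 -lt0n fact_gt0.
exists (fun n => c n * n`!%:R) => n.
rewrite /fps_mul /egf /fps_sub /fps_exp /egf /fps_one /fps_X.
under eq_bigr => i _ do rewrite mulfK //.
case: n => [|n].
  by rewrite big_ord_recl big_ord0 subnn fact0 divr1 subrr mulr0 addr0.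
rewrite big_ord_recr /= subnn fact0 divr1 subrr mulr0 addr0.
rewrite big_ord_recr /= subSnn divr1.
rewrite {2}/c /= nth_rcons sz ltnn eqxx eqSS.
rewrite [X in X + _](_ : _ =
  \sum_(i < n) (egf_bernoulli_seq n)`_i / (n.+1 - i)`!%:R) ?subrKC //.
apply: eq_bigr => i _; rewrite cE // div1r.
by rewrite subn_eq0 leqNgt ltnS ltnW // subr0.
Qed.

(* Main.v *)
Require Import Defs.
From mathcomp Require Import all_boot all_order all_algebra.
From mathcomp Require Import boolp classical_sets fsbigop.
From mathcomp Require Import ring zify.
Set Implicit Arguments.
Unset Strict Implicit.
Unset Printing Implicit Defensive.
Import GRing.Theory Num.Theory.
Local Open Scope ring_scope.

(** The proof computes the power sum one residue class modulo [a] at a time.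

    A number [n] is representable iff [n = J * a + t * d] with [t <= J * (k - 1)]
    (use [J] generators and distribute [t] copies of [d] among them). Since [d]
    is invertible modulo [a], every residue class contains exactly one of the
    numbers [w_r = ceil(r / (k - 1)) * a + r * d] with [r < a], and [w_r] is the
    least representable number of its class: [t] is at least [r] there, and
    the least [J] that goes with [t = r] is the ceiling. So the gaps are the
    numbers below [w_r] and congruent to it ([representable_geq_apery]).

    The scaled Bernoulli polynomial
      [b_N(X) = a ^ N B_N(X / a) = sum_i 'C(N, i) B_i a ^ i X ^ (N - i)]
    satisfies [b_N(x + a) - b_N(x) = a N x ^ (N - 1)], so the gaps in the class of
    [w_r] contribute [(b_N(w_r) - b_N(w_r mod a)) / (a N)], with [N = mu + 1].
    As [r] varies, [w_r mod a] takes every value [c < a] once, and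
    [sum_(c < a) b_N(c) = a B_N] by Raabe's multiplication formula
    ([bernpoly_sum_residues]). This gives [sylvester_sum_apery], which expresses
    the sum through the power sums of the [w_r].

    The binomial expansion of [w_r ^ M] leads to sums of
    [ceil(r / (k - 1)) ^ e * r ^ l]. The ceiling is constant on blocks of length
    [k - 1], so summation by parts ([sum_by_layers]) turns these into sums of
    [r ^ l] over initial segments, and Faulhaber's formula ([sum_powers])
    evaluates them. The inner bracket of the theorem is what the summation by
    parts leaves for one power of the end points ([stepsum]). *)

(** * Bernoulli polynomials *)

(** The defining identity of power series, read off in degree [n] and multiplied
    by [n!]; the subtracted constant term of the exponential removes the summand
    [i = n]. *)
Lemma bernoulli_recurrence (B : nat -> rat) (n : nat) :
  bernoulli_numbers B -> \sum_(i < n) 'C(n, i)%:R * B i = (n == 1)%N%:R.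
Proof.
move=> hB; have f0 m : m`!%:R != 0 :> rat by rewrite pnatr_eq0 -lt0n fact_gt0.
have := congr1 (fun x : rat => n`!%:R * x) (hB n).
rewrite /fps_mul /egf /fps_sub /fps_exp /egf /fps_one /fps_X.
rewrite big_ord_recr /= subnn fact0 divr1 subrr mulr0 addr0.
have -> : n`!%:R * (n == 1)%N%:R = (n == 1)%N%:R :> rat.
  by case: eqP => [->|_]; rewrite ?fact0 ?mulr0 // mulr1.
move=> <-; rewrite mulr_sumr; apply: eq_bigr => i _.
rewrite subn_eq0 leqNgt ltn_ord subr0 -(bin_fact (ltnW (ltn_ord i))) !natrM.
by field; rewrite !f0.
Qed.

Lemma deriv_eq0_polyC (R : numDomainType) (p : {poly R}) :
  p^`() = 0 -> p = (p.[0])%:P.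
Proof.
move=> dp0; apply/polyP => -[|i]; rewrite coefC /= ?horner_coef0 //.
have := congr1 (fun q : {poly R} => q`_i) dp0.
by rewrite /= coef_deriv coef0 => /eqP; rewrite mulrn_eq0 => /eqP.
Qed.

(** [p - p(0)] vanishes at every natural number. *)
Lemma periodic_polyC (R : numDomainType) (p : {poly R}) :
  (forall x, p.[x + 1] = p.[x]) -> p = (p.[0])%:P.
Proof.
move=> per; have pn n : p.[n%:R] = p.[0].
  by elim: n => // n IHn; rewrite -addn1 natrD per.
apply/eqP; rewrite -subr_eq0; apply/eqP; set q := p - _.
apply: (@roots_geq_poly_eq0 _ q [seq i%:R | i <- iota 0 (size q)]).
- by apply/allP => _ /mapP[i _ ->]; rewrite rootE /q !hornerE pn subrr.
- rewrite map_inj_uniq ?iota_uniq // => i j /eqP.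
  by rewrite eqr_nat => /eqP.
- by rewrite size_map size_iota.
Qed.

(** For [h != 0] this is [h ^ N * B_N(X / h)], with [B_N] the usual Bernoulli
    polynomial. Keeping the step [h] inside makes the difference equation hold with
    shift [h], without any division. *)
Definition bernpoly (B : nat -> rat) (h : rat) (N : nat) : {poly rat} :=
  \sum_(i < N.+1) ('C(N, i)%:R * B i * h ^+ i) *: 'X^(N - i).

Lemma horner_bernpoly B h N x :
  (bernpoly B h N).[x] = \sum_(i < N.+1) 'C(N, i)%:R * B i * h ^+ i * x ^+ (N - i).
Proof.
by rewrite horner_sum; apply: eq_bigr => i _; rewrite hornerZ hornerXn.
Qed.

Lemma bernpoly_at0 B h N : (bernpoly B h N).[0] = B N * h ^+ N.
Proof.
rewrite horner_bernpoly big_ord_recr /= big1 => [|i _].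
  by rewrite subnn binn add0r mul1r mulr1.
by rewrite expr0n subn_eq0 leqNgt ltn_ord mulr0.
Qed.

Lemma deriv_bernpoly B h N :
  (bernpoly B h N.+1)^`() = N.+1%:R *: bernpoly B h N.
Proof.
rewrite /bernpoly raddf_sum big_ord_recr /= subnn expr0 derivZ derivC scaler0.
rewrite addr0 scaler_sumr; apply: eq_bigr => i _.
have iN : (i <= N)%N by rewrite -ltnS.
rewrite derivZ derivXn subSn //= -scaler_nat !scalerA; congr (_ *: _).
have /(congr1 (fun n => n%:R : rat)) := mul_bin_down N.+1 i.
rewrite /= !natrM subSn // => e; rewrite mulrC !mulrA; congr (_ * _ * _).
by rewrite e.
Qed.

(** Both sides are Appell sequences: differentiation lowers [N] and multiplies by
    [N]. By induction their difference is therefore a constant, and its value at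
    [0] vanishes by the recurrence of the Bernoulli numbers. *)
Lemma bernpoly_shift B h N : bernoulli_numbers B ->
  bernpoly B h N \Po ('X + h%:P) - bernpoly B h N = (h * N%:R) *: 'X^(N.-1).
Proof.
move=> hB; apply/eqP; rewrite -subr_eq0; apply/eqP.
elim: N => [|N IHN].
  rewrite mulr0 scale0r subr0 /bernpoly big_ord1 subnn expr0.
  by rewrite linearZ /= comp_polyC subrr.
set p := (X in X = 0).
have dp : p^`() = 0.
  rewrite /p !derivB deriv_comp derivD derivX derivC addr0 mulr1.
  rewrite deriv_bernpoly linearZ /= derivZ derivXn /=.
  transitivity (N.+1%:R *: (bernpoly B h N \Po ('X + h%:P)
     - bernpoly B h N - (h * N%:R) *: 'X^(N.-1))); last by rewrite IHN scaler0.
  rewrite !scalerBr scalerA -scaler_nat scalerA; congr (_ - _ *: _); ring.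
rewrite (deriv_eq0_polyC dp) /p !hornerE horner_comp !hornerE bernpoly_at0.
rewrite horner_bernpoly big_ord_recr /= subnn binn.
rewrite (eq_bigr (fun i : 'I_N.+1 => 'C(N.+1, i)%:R * B i * h ^+ N.+1)); last first.
  move=> i _; rewrite -mulrA -exprD subnKC //; exact/ltnW.
rewrite -mulr_suml bernoulli_recurrence // expr0 !mul1r mulr1 addrK /=.
case: N {IHN p dp} => [|N]; last by rewrite expr0n /= mul0r mulr0 subrr.
by rewrite expr0 expr1 mul1r !mulr1 subrr.
Qed.

Lemma horner_bernpoly_shift B h N x : bernoulli_numbers B ->
  (bernpoly B h N).[x + h] - (bernpoly B h N).[x] = h * N%:R * x ^+ N.-1.
Proof.
move=> /(@bernpoly_shift B h N)/(congr1 (fun p : {poly rat} => p.[x])).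
by rewrite !hornerE horner_comp !hornerE.
Qed.

(** Raabe's multiplication formula at [0]. The polynomial
    [M_n(X) = sum_(c < a) b_n(X + c) - a B_n(X)], with [b_n] of step [a], is
    1-periodic because the sum telescopes, hence constant. Its derivative is
    [n M_(n - 1)], so the constancy of [M_(N + 1)] forces [M_N = 0]. *)
Lemma bernpoly_sum_residues B a N : bernoulli_numbers B ->
  \sum_(c < a) (bernpoly B a%:R N).[c%:R] = a%:R * B N.
Proof.
move=> hB.
pose M n := \sum_(c < a) (bernpoly B a%:R n \Po ('X + c%:R%:P))
            - a%:R *: bernpoly B 1 n.
have dM n : (M n.+1)^`() = n.+1%:R *: M n.
  rewrite /M derivB derivZ deriv_bernpoly scalerBr.
  congr (_ - _); last by rewrite !scalerA mulrC.
  rewrite raddf_sum scaler_sumr; apply: eq_bigr => c _ /=.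
  by rewrite deriv_comp derivD derivX derivC addr0 mulr1 deriv_bernpoly linearZ.
have Mx n x : (M n).[x] = \sum_(c < a) (bernpoly B a%:R n).[x + c%:R]
                          - a%:R * (bernpoly B 1 n).[x].
  rewrite /M !hornerE horner_sum; congr (_ - _); apply: eq_bigr => c _.
  by rewrite horner_comp !hornerE.
have perM n x : (M n).[x + 1] = (M n).[x].
  pose f c := (bernpoly B a%:R n).[x + c%:R].
  have fS : \sum_(c < a) f c.+1 - \sum_(c < a) f c
            = a%:R * n%:R * x ^+ n.-1.
    rewrite -sumrB -(big_mkord xpredT (fun c => f c.+1 - f c)).
    by rewrite telescope_sumr // /f addr0 horner_bernpoly_shift.
  have := horner_bernpoly_shift 1 n x hB; rewrite mul1r => beta1.
  apply/eqP; rewrite -subr_eq0 !Mx.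
  under eq_bigr => c _ do rewrite -addrA nat1r.
  apply/eqP; transitivity (\sum_(c < a) f c.+1 - \sum_(c < a) f c -
    a%:R * ((bernpoly B 1 n).[x + 1] - (bernpoly B 1 n).[x])).
    rewrite /f; ring.
  by rewrite fS beta1 mulrA subrr.
have M0 : M N = 0.
  have := dM N; rewrite (periodic_polyC (perM N.+1)) derivC => /esym/eqP.
  by rewrite scaler_eq0 pnatr_eq0 /= => /eqP.
have /eqP := congr1 (fun p : {poly rat} => p.[0]) M0.
rewrite /= Mx horner0 subr_eq0 bernpoly_at0 expr1n mulr1 => /eqP <-.
by apply: eq_bigr => c _; rewrite add0r.
Qed.

(** Faulhaber's formula. *)
Lemma sum_powers B n l : bernoulli_numbers B ->
  \sum_(r < n) r%:R ^+ l =
  \sum_(j < l.+1) 'C(l.+1, j)%:R * B j / l.+1%:R * n%:R ^+ (l.+1 - j).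
Proof.
move=> hB; have l0 : l.+1%:R != 0 :> rat by rewrite pnatr_eq0.
apply: (mulfI l0); rewrite mulr_sumr.
rewrite -(big_mkord xpredT (fun r => l.+1%:R * r%:R ^+ l)).
rewrite (telescope_sumr_eq (fun c => (bernpoly B 1 l.+1).[c%:R])) //; last first.
  by move=> r _; rewrite -[in RHS]natr1 horner_bernpoly_shift // mul1r.
rewrite bernpoly_at0 expr1n horner_bernpoly big_ord_recr /= subnn binn expr1n.
rewrite mul1r !mulr1 addrK mulr_sumr; apply: eq_bigr => j _.
by rewrite expr1n; field; rewrite addrC natr1.
Qed.

(** * Summation by parts over blocks *)

Definition ceildiv (r p : nat) : nat := ((r + p.-1) %/ p)%N.

Lemma ceildiv_leq r p m : (0 < p)%N -> (ceildiv r p <= m)%N = (r <= m * p)%N.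
Proof. by move=> p0; rewrite -ltnS ltn_divLR // mulSn; lia. Qed.

(** Layer-cake form of summation by parts: [g q.+1 - g c] is the sum of the
    increments of [g] over the [i] with [c <= i <= q], and
    [ceildiv r p <= i] means [r <= i * p]. *)
Lemma sum_by_layers (R : pzRingType) (g f : nat -> R) a p q : (0 < p)%N ->
  (q * p < a)%N -> (a <= (q.+1 * p).+1)%N ->
  \sum_(r < a) g (ceildiv r p) * f r =
  g q.+1 * \sum_(r < a) f r
  - \sum_(i < q.+1) (g i.+1 - g i) * \sum_(r < (i * p).+1) f r.
Proof.
move=> p0 qa aq.
have inner (i : 'I_q.+1) : \sum_(r < (i * p).+1) f r =
    \sum_(r < a) (if (ceildiv r p <= i)%N then f r else 0).
  rewrite -big_mkcond (big_ord_widen a) //=; last first.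
    by apply: leq_ltn_trans qa; rewrite leq_mul2r -ltnS ltn_ord orbT.
  by apply: eq_bigl => r; rewrite ceildiv_leq // ltnS.
under [X in _ - X]eq_bigr => i _ do rewrite inner mulr_sumr.
rewrite exchange_big mulr_sumr -sumrB; apply: eq_bigr => r _.
have cq : (ceildiv r p <= q.+1)%N.
  by rewrite ceildiv_leq // -ltnS (leq_trans (ltn_ord r)).
rewrite (eq_bigr (fun i : 'I_q.+1 => if (ceildiv r p <= i)%N
           then (g i.+1 - g i) * f r else 0)); last first.
  by move=> i _; case: ifP => //; rewrite mulr0.
rewrite -big_mkcond -(big_mkord (fun i => ceildiv r p <= i)%N
  (fun i => (g i.+1 - g i) * f r)) -mulr_suml -mulrBl; congr (_ * _).
have -> : \sum_(0 <= i < q.+1 | (ceildiv r p <= i)%N) (g i.+1 - g i)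
  = \sum_(ceildiv r p <= i < q.+1) (g i.+1 - g i).
  rewrite (@big_cat_nat _ _ _ (ceildiv r p)) //= [X in X + _]big_nat_cond big_pred0 ?add0r.
    by rewrite big_nat_cond [RHS]big_nat_cond; apply: eq_bigl => i; lia.
  by move=> i; lia.
by rewrite telescope_sumr // subKr.
Qed.

(** * The least representable number of each residue class *)

Lemma representable0 s : representable s 0.
Proof.
by exists (fun=> 0%N); rewrite big1 // => i _; rewrite mul0n.
Qed.

Lemma representable_addl s m n :
  m \in s -> representable s n -> representable s (m + n).
Proof.
move=> ms [c ->]; have im : (index m s < size s)%N by rewrite index_mem.
exists (fun j => ((j == Ordinal im) + c j)%N).
under [RHS]eq_bigr => j _ do rewrite mulnDl.
rewrite big_split /=; congr (_ + _)%N.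
rewrite (bigD1 (Ordinal im)) //= eqxx mul1n nth_index // big1 ?addn0 //.
by move=> j /negbTE->.
Qed.

(** [J] counts the generators used, and [t] the copies of [d] beyond [J * a]. For
    the converse, each generator takes as many of the remaining copies of [d] as
    it can, that is at most [k - 1]. *)
Lemma representable_arith_prog a d k n : (0 < k)%N ->
  representable (arith_prog a d k) n <->
  exists J t, (t <= J * k.-1)%N /\ n = (J * a + t * d)%N.
Proof.
move=> k0; split=> [[c ->]|[J [t [tJ ->]]]].
  have ik (i : 'I_(size (arith_prog a d k))) : (i < k)%N.
    by apply: leq_trans (ltn_ord i) _; rewrite size_mkseq.
  exists (\sum_i c i)%N, (\sum_i c i * i)%N; split.
    rewrite big_distrl /=; apply: leq_sum => i _; rewrite leq_mul2l.
    by have := ik i; case: (c i == 0%N) => //=; lia.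
  rewrite !big_distrl -big_split /=; apply: eq_bigr => i _.
  by rewrite nth_mkseq ?mulnDr ?mulnA.
elim: J t tJ => [|J IHJ] t tJ.
  have -> : t = 0%N by lia.
  exact: representable0.
have [i [u [ik uJ ->]]] : exists i u, [/\ (i < k)%N, (u <= J * k.-1)%N & t = (i + u)%N].
  exists (minn t k.-1), (t - minn t k.-1)%N; rewrite mulSn in tJ.
  by move: (J * k.-1)%N tJ => Jk tJ; split; lia.
have -> : (J.+1 * a + (i + u) * d = (a + i * d) + (J * a + u * d))%N.
  by rewrite mulSn mulnDl addnACA.
by apply: representable_addl (IHJ u uJ); apply/mapP; exists i => //; rewrite mem_iota.
Qed.

(** With [p = k - 1], [d] coprime to [a] and [r < a], these are the
    elements of the Apery set with respect to [a] of the semigroup generated by the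
    progression: [r] copies of [d] require at least [ceildiv r p] generators. *)
Definition apery (a d p r : nat) : nat := (ceildiv r p * a + r * d)%N.

(** If [n = J * a + t * d] lies in the class of [apery a d k.-1 r], then [t] is
    congruent to [r] modulo [a] because [d] is invertible; as [r < a], this gives
    [r <= t]. Conversely, adding multiples of [a] only increases [J]. *)
Lemma representable_geq_apery a d k r n : (1 < k)%N -> coprime a d -> (r < a)%N ->
  (n = apery a d k.-1 r %[mod a])%N ->
  representable (arith_prog a d k) n <-> (apery a d k.-1 r <= n)%N.
Proof.
move=> k1 had ra; have p0 : (0 < k.-1)%N by lia.
rewrite /apery modnMDl => nr; rewrite representable_arith_prog; last lia.
split=> [[J [t [tJ nE]]]|wn].
  move: nr; rewrite nE modnMDl => /esym/eqP nr.
  have rt : (r <= t)%N.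
    case: (ltnP t r) => // tr; move: nr.
    rewrite eqn_mod_dvd ?leq_mul2r ?(ltnW tr) ?orbT //.
    by rewrite -mulnBl Gauss_dvdl // => /dvdn_leq; lia.
  by rewrite leq_add ?leq_mul2r ?rt ?orbT // ceildiv_leq ?(leq_trans rt tJ) ?orbT.
have : (a %| n - (ceildiv r k.-1 * a + r * d))%N.
  by rewrite -eqn_mod_dvd // modnMDl; apply/eqP.
case/dvdnP => v vE; exists (ceildiv r k.-1 + v)%N, r; split.
  by rewrite -ceildiv_leq // leq_addr.
by rewrite mulnDl -addnA (addnC (v * a)%N) addnA -vE subnKC.
Qed.

Lemma apery_inj a d p : coprime a d ->
  {in gtn a &, injective (fun r => (apery a d p r) %% a)%N}.
Proof.
move=> had; suff lt_impl r s : (r <= s)%N -> (s < a)%N ->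
    (apery a d p r %% a = apery a d p s %% a)%N -> r = s.
  move=> r s; rewrite !inE => ra sa e; case/orP: (leq_total r s) => rs.
    exact: lt_impl.
  by apply/esym/lt_impl.
move=> rs sa /esym/eqP; rewrite !modnMDl eqn_mod_dvd ?leq_mul2r ?rs ?orbT //.
rewrite -mulnBl Gauss_dvdl //; case: (posnP (s - r)); first by lia.
by move=> sr /dvdn_leq; lia.
Qed.

(** * Sums over the gaps *)

Lemma sum_below_in_class (V : zmodType) (F G : nat -> V) a w : (0 < a)%N ->
  (forall n, G (n + a)%N - G n = F n) ->
  \sum_(0 <= n < w | n == w %[mod a]) F n = G w - G (w %% a)%N.
Proof.
move=> a0 GF; have ca := ltn_pmod w a0.
rewrite (divn_eq w a) modnMDl modn_mod.
move: (w %/ a)%N (w %% a)%N ca => t c ca.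
elim: t => [|t IHt].
  rewrite mul0n add0n subrr big_nat_cond big_pred0 // => n.
  by apply/negP => /andP[/andP[_ nc]]; rewrite modn_small ?(ltn_trans nc) //; lia.
have le_tS : (t * a + c <= t.+1 * a + c)%N by rewrite mulSn; lia.
have lt_tS : (t * a + c < t.+1 * a + c)%N by rewrite mulSn; lia.
rewrite (@big_cat_nat _ _ _ (t * a + c)) //= IHt big_ltn_cond //.
rewrite modnMDl (modn_small ca) eqxx big_nat_cond big_pred0 => [|n].
  by rewrite addr0 -GF mulSnr addnAC addrC addrA addrNK.
apply/negP => /andP[/andP[n1 n2] /eqP nc].
have : (a %| n - (t * a + c))%N.
  by rewrite -eqn_mod_dvd ?(ltnW n1) // modnMDl nc (modn_small ca).
by move: n1 n2 => + + /dvdn_leq; rewrite mulSn; lia.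
Qed.

(** In each class the sum of [F] over the gaps telescopes to the difference of
    [G] between the least member of [S] and the residue; since the [w r] hit every
    residue once, the lower ends add up to the sum of [G] over all residues. *)
Lemma sum_gaps (V : zmodType) (S : nat -> Prop) (w : nat -> nat) (F G : nat -> V) a :
  (0 < a)%N ->
  {in gtn a &, injective (fun r => w r %% a)%N} ->
  (forall r n, (r < a)%N -> (n = w r %[mod a])%N -> S n <-> (w r <= n)%N) ->
  (forall n, G (n + a)%N - G n = F n) ->
  \sum_(n \in [set n | ~ S n]%classic) F n =
  \sum_(r < a) G (w r) - \sum_(c < a) G c.
Proof.
move=> a0 winj Sw GF.
pose h (r : 'I_a) : 'I_a := Ordinal (ltn_pmod (w r) a0).
have h_inj : injective h.
  by move=> r s /(congr1 val) /= e; apply/val_inj/winj; rewrite ?inE ?ltn_ord.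
pose N := (\max_(r < a) w r)%N.
have wN (r : 'I_a) : (w r <= N)%N by rewrite /N (leq_bigmax r).
pose gap n := `[< ~ S n >].
(* [cl n] is the index of the unique [w r] congruent to [n]. *)
pose cl n : 'I_a := invF h_inj (Ordinal (ltn_pmod n a0)).
have clE n (r : 'I_a) : (n == w r %[mod a]) = (r == cl n).
  rewrite -(inj_eq h_inj) f_invF -val_eqE /= eq_sym //.
have gapE n : gap n = (n < w (cl n))%N.
  have nc : (n = w (cl n) %[mod a])%N by apply/eqP; rewrite clE.
  have Sn := Sw _ _ (ltn_ord (cl n)) nc.
  apply/asboolP/idP; first by move=> nS; rewrite ltnNge; apply/negP => /Sn.
  by rewrite ltnNge => /negP wn /Sn.
have -> : [set n | ~ S n]%classic = [set` [seq n <- iota 0 N | gap n]]%classic.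
  apply/seteqP; split => n /=; rewrite mem_filter mem_iota.
    move=> nS; have ng : gap n by apply/asboolP.
    by rewrite ng /= add0n (leq_trans _ (wN (cl n))) // -gapE.
  by case/andP => /asboolP.
rewrite -fsbig_seq ?filter_uniq ?iota_uniq // big_filter.
have -> : \sum_(n <- iota 0 N | gap n) F n =
    \sum_(0 <= n < N) \sum_(r < a | (n == w r %[mod a]) && (n < w r)%N) F n.
  rewrite /index_iota subn0 big_mkcond; apply: eq_bigr => n _.
  rewrite gapE (eq_bigl (fun r => (r == cl n) && (n < w (cl n))%N)) => [|r].
    case: ifP => nw; last by rewrite big_pred0 // => r; rewrite andbF.
    by under eq_bigl => r do rewrite andbT; rewrite big_pred1_eq.
  by rewrite clE; case: eqP => // ->.
rewrite (exchange_big_dep xpredT) //=.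
rewrite [X in _ - X](reindex_inj h_inj) /= -sumrB; apply: eq_bigr => r _.
by rewrite -big_nat_widen // (sum_below_in_class _ a0 GF).
Qed.

(** * Power sums of the Apery set *)

(** What summation by parts makes of [ceildiv r p ^ e * f r] when the sum of [f]
    over [r < x] is replaced by the single power [x ^ m]. *)
Definition stepsum (a p q e m : nat) : rat :=
  q.+1%:R ^+ e * a%:R ^+ m - 1
  - \sum_(1 <= i < q.+1) (i.+1%:R ^+ e - i%:R ^+ e) * (i * p).+1%:R ^+ m.

(** The power [i ^ e], except that [posexp 0 0 = 0] in contrast to [0 ^+ 0 = 1]:
    only then is the first increment in [sum_by_layers] equal to [1] for every
    [e], which is the term [- 1] of [stepsum]. *)
Definition posexp (e i : nat) : rat := if i is 0 then 0 else i%:R ^+ e.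

Lemma sum_posexp_ceildiv B a p e l : bernoulli_numbers B -> (0 < p)%N ->
  (0 < a)%N ->
  \sum_(r < a) posexp e (ceildiv r p) * r%:R ^+ l =
  \sum_(j < l.+1) 'C(l.+1, j)%:R * B j / l.+1%:R
                  * stepsum a p (a.-1 %/ p) e (l.+1 - j).
Proof.
move=> hB p0 a0; set q := (a.-1 %/ p)%N.
rewrite (sum_by_layers _ (fun r => r%:R ^+ l) p0 (q := q)); first last.
- by have := ltn_ceil a.-1 p0; rewrite -/q; lia.
- by have := leq_divM a.-1 p; rewrite -/q; lia.
rewrite (sum_powers a l hB).
under [X in _ - X]eq_bigr => i _ do rewrite (sum_powers _ l hB) mulr_sumr.
rewrite exchange_big mulr_sumr -sumrB; apply: eq_bigr => j _ /=.
rewrite /stepsum big_ord_recl /= mul0n expr1n !expr1n subr0 mul1r.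
rewrite big_add1 /= big_mkord.
set c := 'C(l.+1, j)%:R * B j / l.+1%:R.
rewrite (eq_bigr (fun i : 'I_q => c * ((i.+2%:R ^+ e - i.+1%:R ^+ e)
   * (i.+1 * p).+1%:R ^+ (l.+1 - j)))); last by move=> i _; rewrite /= /bump; ring.
by rewrite -mulr_sumr; ring.
Qed.

(** Positivity of [M] is what allows [posexp] in place of the power: at [r = 0],
    where they may differ, the exponents of [ceildiv r p] and of [r] add up to [M],
    so every term of the expansion vanishes under both readings. *)
Lemma sum_apery_powers B a d p M : bernoulli_numbers B -> (0 < p)%N ->
  (0 < a)%N -> (0 < M)%N ->
  \sum_(r < a) (apery a d p r)%:R ^+ M =
  \sum_(l < M.+1) \sum_(j < l.+1) 'C(M, l)%:R * a%:R ^+ (M - l) * d%:R ^+ l *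
     ('C(l.+1, j)%:R * B j / l.+1%:R
       * stepsum a p (a.-1 %/ p) (M - l) (l.+1 - j)).
Proof.
move=> hB p0 a0 M0.
under [RHS]eq_bigr => l _ do
  rewrite -mulr_sumr -(sum_posexp_ceildiv _ _ hB p0 a0) mulr_sumr.
rewrite exchange_big; apply: eq_bigr => r _.
rewrite /apery natrD !natrM exprDn; apply: eq_bigr => l _.
rewrite -mulr_natl !exprMn.
have -> : posexp (M - l) (ceildiv r p) * r%:R ^+ l =
   (ceildiv r p)%:R ^+ (M - l) * r%:R ^+ l.
  case: (posnP (ceildiv r p)) => [c0|]; last by case: (ceildiv r p).
  have -> : nat_of_ord r = 0%N.
    by apply/eqP; rewrite -leqn0 -(mul0n p) -ceildiv_leq // c0.
  by rewrite /ceildiv divn_small ?mul0r ?add0n ?prednK // -exprD subnK -1?ltnS // expr0n gtn_eqF.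
by ring.
Qed.

(** * The Sylvester sum *)

Lemma NR_compl s : NR s = [set n | ~ representable s n]%classic.
Proof.
apply/seteqP; split=> n /=; first by case.
by case: n => [/(_ (representable0 s))|].
Qed.

(** The antidifference with step [a] of [n ^ mu] is the Bernoulli polynomial of
    degree [mu + 1] and step [a], divided by [a * (mu + 1)]. *)
Lemma sylvester_sum_apery B a d k mu : bernoulli_numbers B ->
  (0 < a)%N -> coprime a d -> (1 < k)%N ->
  sylvester_sum mu (arith_prog a d k) =
  (\sum_(r < a) (bernpoly B a%:R mu.+1).[(apery a d k.-1 r)%:R] - a%:R * B mu.+1)
  / (a%:R * mu.+1%:R).
Proof.
move=> hB a0 had k1; rewrite /sylvester_sum NR_compl.
have aN : a%:R != 0 :> rat by rewrite pnatr_eq0 -lt0n.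
have muN : mu.+1%:R != 0 :> rat by rewrite pnatr_eq0.
rewrite (sum_gaps (w := apery a d k.-1)
  (G := fun n => (bernpoly B a%:R mu.+1).[n%:R] / (a%:R * mu.+1%:R)) a0).
- by rewrite -!mulr_suml bernpoly_sum_residues // mulrBl.
- exact: apery_inj.
- by move=> r n; apply: representable_geq_apery.
- move=> n; rewrite -mulrBl natrD horner_bernpoly_shift //=.
  by rewrite mulrAC divff ?mul1r // mulf_neq0.
Qed.

Theorem theorem2 (B : nat -> rat) (hB : bernoulli_numbers B)
    (a d k mu : nat) (ha : (0 < a)%N) (hd : (0 < d)%N)
    (had : coprime a d) (hk2 : (2 <= k)%N) (hka : (k <= a)%N) :
  sylvester_sum mu (arith_prog a d k) =
    ((mu + 1)%:R)^-1 *
      (\sum_(0 <= kappa < mu.+1)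
        \sum_(0 <= l < (mu + 1 - kappa).+1)
          \sum_(0 <= j < l.+1)
            'C(mu + 1, kappa)%:R * 'C(mu + 1 - kappa, l)%:R * 'C(l + 1, j)%:R
            * (B kappa * B j * a%:R ^ (mu%:Z - l%:Z) * d%:R ^+ l / (l + 1)%:R)
            * (((a - 1) %/ (k - 1) + 1)%:R ^+ (mu + 1 - kappa - l)
                 * a%:R ^+ (l + 1 - j)
               - 1
               - \sum_(1 <= i < ((a - 1) %/ (k - 1)).+1)
                   ((i + 1)%:R ^+ (mu + 1 - kappa - l)
                    - i%:R ^+ (mu + 1 - kappa - l))
                   * (i * (k - 1) + 1)%:R ^+ (l + 1 - j)))
    + B (mu + 1)%N / (mu + 1)%:R * (a%:R ^+ (mu + 1) - 1).
Proof.
have aN : a%:R != 0 :> rat by rewrite pnatr_eq0 -lt0n.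
have muN : mu.+1%:R != 0 :> rat by rewrite pnatr_eq0.
have p0 : (0 < k.-1)%N by lia.
rewrite (sylvester_sum_apery mu hB) // !addn1 big_mkord.
(* The summand [kappa = mu + 1] of the Bernoulli polynomial is constant in [r]; it
   gives the term with [B (mu + 1)] outside the triple sum. *)
under eq_bigr => r _ do rewrite horner_bernpoly big_ord_recr /= subnn binn expr0.
rewrite big_split /= sumr_const card_ord exchange_big /= -[X in _ + X - _]mulr_natl.
set S := \sum_(i < mu.+1) _; set T := \sum_(i < mu.+1) _.
suff -> : S = a%:R * T.
  rewrite mul1r mulr1 exprS.
  by field; rewrite nat1r muN.
rewrite /S /T mulr_sumr; apply: eq_bigr => kappa _.
rewrite -mulr_sumr (sum_apery_powers _ hB) ?subn_gt0 // mulr_sumr mulr_sumr big_mkord.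
apply: eq_bigr => l _; rewrite mulr_sumr mulr_sumr big_mkord.
apply: eq_bigr => j _; rewrite /stepsum !subn1 !addn1.
under [X in _ = _ * (_ * (_ - X))]eq_bigr => i _ do rewrite !addn1.
(* The exponent is negative when [l = mu + 1], whence the division by [a]. *)
have -> : a%:R ^ (mu%:Z - l%:Z) = a%:R ^+ kappa * a%:R ^+ (mu.+1 - kappa - l) / a%:R :> rat.
  have lM := ltn_ord l; have kM := ltn_ord kappa.
  have e : (mu%:Z - l%:Z = (kappa + (mu.+1 - kappa - l))%N%:Z - 1)%R by lia.
  by rewrite e expfzDr // exprN1 -exprnP exprD.
by field; rewrite nat1r pnatr_eq0.
Qed.
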